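(* Let $\mathcal X$ be an ordered topological vector space, let $\mathcal A\subset\mathcal X$ be a convex acceptance set with nonempty interior, and $S=(S_0,S_T)$ a traded asset. If $S_T$ is strictly positive, then $\rho_{\mathcal A,S}$ is finitely valued and continuous.
   Context: An ordered topological vector space $\mathcal X$ is a Hausdorff real topological vector space ordered by a pointed convex cone $\mathcal X_+$ ($\mathcal X_+\cap(-\mathcal X_+)=\{0\}$); $X\le Y$ means $Y-X\in\mathcal X_+$. $\mathcal X'$ is the topological dual and $\mathcal X'_+=\{\psi\in\mathcal X' : \psi(X)\ge0 \text{ for all } X\in\mathcal X_+\}$. An element $Z\in\mathcal X_+$ is strictly positive if $\psi(Z)>0$ for all nonzero $\psi\in\mathcal X'_+$. An acceptance set is a nonempty proper subset $\mathcal A\subset\mathcal X$ such that $X\in\mathcal A$ and $Y\ge X$ imply $Y\in\mathcal A$. A traded asset is a pair $S=(S_0,S_T)$ with $S_0>0$ a real number and $S_T\in\mathcal X_+$ nonzero. The associated risk measure $\rho_{\mathcal A,S}:\mathcal X\to\mathbb R\cup\{\pm\infty\}$ is $$\rho_{\mathcal A,S}(X)=\inf\{m\in\mathbb R : X+\tfrac{m}{S_0}S_T\in\mathcal A\},$$ with $\inf\emptyset=\infty$. *)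

(* Defs.v *)
From HB Require Import structures.
From mathcomp Require Import all_boot all_order all_algebra.
From mathcomp Require Import all_classical all_reals all_analysis.

Set Implicit Arguments.
Unset Strict Implicit.
Unset Printing Implicit Defensive.

Import Order.TTheory GRing.Theory Num.Theory.
Import numFieldNormedType.Exports.

Local Open Scope classical_set_scope.
Local Open Scope ring_scope.

Section OrderedTopologicalVectorSpace.
(* [topologicalLmodType] is a topological vector space that need not be locally
   convex, unlike [tvsType]. *)
Context {R : realType} {X : topologicalLmodType R}.
Implicit Types (P A : set X) (x y : X).

Definition convex_cone P : Prop :=
  convex_set P /\ forall (a : R) x, 0 <= a -> P x -> P (a *: x).

Definition pointed_cone P : Prop :=
  P `&` [set - x | x in P] = [set 0].

(* [P] is the positive cone of an order making [X] an ordered topological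
   vector space. *)
Definition ordered_tvs P : Prop :=
  [/\ hausdorff_space X, convex_cone P & pointed_cone P].

Definition cone_le P x y : Prop := P (y - x).

Definition topological_dual : set {scalar X} :=
  [set psi : {scalar X} | continuous (psi : X -> R)].

Definition dual_cone P : set {scalar X} :=
  [set psi : {scalar X} | topological_dual psi /\ forall x, P x -> 0 <= psi x].

Definition strictly_positive P (z : X) : Prop :=
  P z /\ forall psi : {scalar X},
    dual_cone P psi -> (psi : X -> R) <> (fun=> 0) -> 0 < psi z.

Definition acceptance_set P A : Prop :=
  [/\ A !=set0, A <> setT & forall x y, A x -> cone_le P x y -> A y].

Definition traded_asset P (S : R * X) : Prop :=
  [/\ 0 < S.1, P S.2 & S.2 <> 0].

(* [ereal_inf set0] is [+oo]. *)
Definition risk_measure A (S : R * X) (x : X) : \bar R :=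
  ereal_inf [set m%:E | m in [set m : R | A (x + (m / S.1) *: S.2)]].

End OrderedTopologicalVectorSpace.

(* Main.v *)
(* A hyperplane separating a convex upward closed set from a point outside it is
   given, up to sign, by a nonzero functional in the dual cone.  If the set
   contained a line directed by [S_T], that functional would vanish at [S_T],
   against strict positivity.  Applied to [A + R S_T] this shows that every line
   directed by [S_T] meets [A], even its interior; applied to [A] it shows that
   no such line lies in [A].  Hence the risk measure is finite, and convexity of
   [A] makes it both upper and lower semicontinuous.  The space need not be
   locally convex: separation uses the gauge of a convex neighborhood of [0], and
   Hahn-Banach follows from Zorn's lemma because a minimal sublinear functional
   is linear. *)
Require Import Defs.
From HB Require Import structures.
From mathcomp Require Import all_boot all_order all_algebra.
From mathcomp Require Import all_classical all_reals all_analysis.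
From mathcomp Require Import ring lra.
Import Order.TTheory GRing.Theory Num.Theory.
Import numFieldNormedType.Exports.
Local Open Scope classical_set_scope.
Local Open Scope ring_scope.

(** * Sublinear functionals and Hahn-Banach *)

Lemma le_inf_add {R : realType} (B C : set R) (c : R) :
  B !=set0 -> C !=set0 -> (forall b d, B b -> C d -> c <= b + d) ->
  c <= inf B + inf C.
Proof.
move=> B0 C0 cBC; rewrite -lerBlDr; apply: lb_le_inf => // b Bb.
rewrite lerBlDr addrC -lerBlDr; apply: lb_le_inf => // d Cd.
by rewrite lerBlDr addrC; exact: cBC.
Qed.

Lemma le_inf_mul {R : realType} (B : set R) (a c : R) :
  0 < a -> B !=set0 -> (forall b, B b -> c <= a * b) -> c <= a * inf B.
Proof.
move=> a0 B0 cB; rewrite mulrC -ler_pdivrMr//; apply: lb_le_inf => // b Bb.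
by rewrite ler_pdivrMr// mulrC; exact: cB.
Qed.

(* With [a = 0] the second clause gives [p 0 <= 0]; equality in it for
   [0 <= a] follows. *)
Definition sublinear {R : realType} {V : lmodType R} (p : V -> R) : Prop :=
  (forall x y, p (x + y) <= p x + p y) /\
  (forall a x, 0 <= a -> p (a *: x) <= a * p x).

Lemma sublinear0 {R : realType} {V : lmodType R} (p : V -> R) :
  sublinear p -> p 0 = 0.
Proof.
move=> [pD pZ]; have := pZ 0 0 (lexx _); rewrite scale0r mul0r.
by have := pD 0 0; rewrite addr0; lra.
Qed.

Lemma sublinearZ {R : realType} {V : lmodType R} (p : V -> R) a x :
  sublinear p -> 0 <= a -> p (a *: x) = a * p x.
Proof.
move=> sp; rewrite le_eqVlt => /predU1P[<-|a0].
  by rewrite scale0r mul0r sublinear0.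
apply/eqP; rewrite eq_le (sp.2 _ _ (ltW a0))/=.
have := sp.2 a^-1 (a *: x); rewrite invr_ge0 (ltW a0) => /(_ isT).
by rewrite scalerA mulVf ?gt_eqF// scale1r mulrC ler_pdivlMr// mulrC.
Qed.

Lemma sublinear_geN {R : realType} {V : lmodType R} (p : V -> R) x :
  sublinear p -> - p (- x) <= p x.
Proof.
by move=> sp; have := sp.1 x (- x); rewrite subrr sublinear0//; lra.
Qed.

(* The largest sublinear functional below [p] whose value at [- z] is at most
   [- p z]. *)
Definition tilt {R : realType} {V : lmodType R} (p : V -> R) (z : V) : V -> R :=
  fun x => inf [set p (x + t *: z) - t * p z | t in [set t | 0 <= t]].

Section tilt.
Context {R : realType} {V : lmodType R} (p : V -> R) (z : V).
Hypothesis sp : sublinear p.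

Let T x := [set p (x + t *: z) - t * p z | t in [set t : R | 0 <= t]].

Let T_neq0 x : T x !=set0.
Proof. by exists (p (x + 0 *: z) - 0 * p z), 0 => /=. Qed.

Let T_lb x : has_lbound (T x).
Proof.
(* Subadditivity at [t *: z = (x + t *: z) + (- x)] gives a bound independent of [t]. *)
exists (- p (- x)) => _ [t /= t0 <-].
have := sp.1 (x + t *: z) (- x); rewrite [x + _]addrC addrK.
by rewrite (sublinearZ _ _ _ sp t0); lra.
Qed.

Lemma tilt_ub x (t : R) : 0 <= t -> tilt p z x <= p (x + t *: z) - t * p z.
Proof. by move=> t0; apply: ge_inf; [exact: T_lb|exists t]. Qed.

Lemma tilt_le x : tilt p z x <= p x.
Proof. by have := tilt_ub x 0 (lexx _); rewrite scale0r addr0 mul0r subr0. Qed.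

Lemma tiltN : tilt p z (- z) <= - p z.
Proof.
have := tilt_ub (- z) 1 ler01.
by rewrite scale1r addNr mul1r sublinear0// sub0r.
Qed.

Lemma tilt_sublinear : sublinear (tilt p z).
Proof.
split=> [x y|a x].
  apply: le_inf_add; [exact: T_neq0|exact: T_neq0|].
  move=> _ _ [s /= s0 <-] [t /= t0 <-].
  apply: le_trans (tilt_ub _ (s + t) (addr_ge0 s0 t0)) _.
  have := sp.1 (x + s *: z) (y + t *: z).
  by rewrite addrACA -scalerDl mulrDl; lra.
rewrite le_eqVlt => /predU1P[<-|a0].
  by rewrite scale0r mul0r (le_trans (tilt_le _))// sublinear0.
apply: le_inf_mul; [by []|exact: T_neq0|move=> _ [t /= t0 <-]].
apply: le_trans (tilt_ub _ (a * t) (mulr_ge0 (ltW a0) t0)) _.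
by rewrite -scalerA -scalerDr (sublinearZ _ _ _ sp (ltW a0)) mulrBr mulrA.
Qed.

End tilt.

(** Zorn's lemma for the reversed pointwise order, so that a maximal element is a minimal
    functional. A nonempty chain is bounded by its pointwise infimum, finite because every sublinear
    [q] below [p] satisfies [- p (- x) <= q x]. *)
Lemma minimal_sublinear {R : realType} {V : lmodType R} (p : V -> R) :
  sublinear p ->
  exists q : V -> R, [/\ sublinear q, forall x, q x <= p x &
    forall r, sublinear r -> (forall x, r x <= q x) -> forall x, q x <= r x].
Proof.
move=> sp; pose T := {q : V -> R | sublinear q /\ forall x, q x <= p x}.
pose ge (q r : T) := `[< forall x, sval r x <= sval q x >].
have [||F totF|[q [sq qp]] qmin] :=
  @ZL_preorder T (exist _ p (conj sp (fun=> lexx _))) ge.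
- by move=> q; apply/asboolP.
- move=> q r s /asboolP rq /asboolP sr; apply/asboolP => x.
  exact: le_trans (sr x) (rq x).
- have [[q0 Fq0]|/set0P/negP/negPn/eqP F0] := pselect (F !=set0); last first.
    by exists (exist _ p (conj sp (fun=> lexx _))) => q; rewrite F0.
  pose B x := [set sval q x | q in F].
  have B0 x : B x !=set0 by exists (sval q0 x), q0.
  have Blb x : has_lbound (B x).
    exists (- p (- x)) => _ [q Fq <-]; case: (svalP q) => sq qp.
    by apply: le_trans (sublinear_geN _ x sq); rewrite lerN2.
  pose m x := inf (B x).
  have mF q x : F q -> m x <= sval q x.
    by move=> Fq; apply: ge_inf; [exact: Blb|exists q].
  have sm : sublinear m.
    split=> [x y|a x].
      apply: le_inf_add; [exact: B0|exact: B0|move=> _ _ [q Fq <-] [r Fr <-]].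
      (* The smaller of [q] and [r] serves both arguments, which makes the infimum subadditive. *)
      case: (totF _ _ Fq Fr) => /asboolP qr.
        apply: le_trans (mF _ _ Fr) (le_trans ((svalP r).1.1 _ _) _).
        by rewrite lerD2r.
      apply: le_trans (mF _ _ Fq) (le_trans ((svalP q).1.1 _ _) _).
      by rewrite lerD2l.
    rewrite le_eqVlt => /predU1P[<-|a0].
      rewrite scale0r mul0r (le_trans (mF _ _ Fq0))// sublinear0//.
      exact: (svalP q0).1.
    apply: le_inf_mul; [by []|exact: B0|move=> _ [q Fq <-]].
    apply: le_trans (mF _ _ Fq) _.
    exact: ((svalP q).1.2 _ _ (ltW a0)).
  have mp x : m x <= p x by exact: le_trans (mF _ x Fq0) ((svalP q0).2 x).
  exists (exist _ m (conj sm mp)) => q Fq; apply/asboolP => x /=.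
  exact: mF.
- exists q; split=> // r sr rq x.
  have rp y : r y <= p y by exact: le_trans (rq y) (qp y).
  have := qmin (exist _ r (conj sr rp)).
  by move=> /(_ (asboolT rq))/asboolP; exact.
Qed.

(** A minimal [q] below [tilt p z] lies below each of its own tilts, so [tiltN] makes it odd; an odd
    sublinear functional is linear. Starting from the tilt at [z] forces the value [p z] there. *)
Lemma hahn_banach_sublinear {R : realType} {V : lmodType R} (p : V -> R)
    (z : V) :
  sublinear p ->
  exists f : {scalar V}, (forall x, f x <= p x) /\ f z = p z.
Proof.
move=> sp.
have [q [sq qt qmin]] := minimal_sublinear _ (tilt_sublinear p z sp).
have qN x : q (- x) = - q x.
  apply/eqP; rewrite eq_le; apply/andP; split; last first.
    by have := sublinear_geN _ (- x) sq; rewrite opprK.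
  apply: le_trans (tiltN q x sq).
  by apply: (qmin _ (tilt_sublinear q x sq)); exact: tilt_le.
have qD x y : q (x + y) = q x + q y.
  apply/eqP; rewrite eq_le sq.1/=.
  by have := sq.1 (- x) (- y); rewrite -opprD !qN; lra.
have q_lin : scalar q.
  move=> a x y; rewrite qD; congr (_ + _).
  have [a0|a0] := leP 0 a; first exact: sublinearZ.
  by rewrite -[a]opprK scaleNr qN sublinearZ ?mulNr// oppr_ge0 ltW.
pose f : {scalar V} := HB.pack q (GRing.isLinear.Build R V R *%R q q_lin).
exists f; split=> [x|]; first exact: le_trans (qt x) (tilt_le p z sp x).
apply/eqP; rewrite eq_le (le_trans (qt z) (tilt_le p z sp z))/=.
by rewrite -lerN2 -[- f z]qN; exact: le_trans (qt _) (tiltN p z sp).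
Qed.

(** * Convex sets and continuity in a topological vector space *)

Lemma convex_combo {R : realType} {V : lmodType R} (A : set V) (t : R) x y :
  convex_set A -> 0 <= t <= 1 -> A x -> A y -> A (t *: x + (1 - t) *: y).
Proof.
move=> cA /andP[t0 t1] Ax Ay.
by have := cA x y (Itv01 t0 t1); rewrite !inE; apply.
Qed.

Lemma convex_setP {R : realType} {V : lmodType R} (A : set V) :
  (forall (t : R) x y, 0 <= t <= 1 -> A x -> A y ->
    A (t *: x + (1 - t) *: y)) ->
  convex_set A.
Proof.
move=> cA x y l; rewrite !inE => Ax Ay.
by apply: (cA l%:num) => //; rewrite ge0 le1.
Qed.

Section topological_vector_space.
Context {R : realType} {X : topologicalLmodType R}.

Lemma cvgZD {T : Type} (F : set_system T) {FF : Filter F}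
    (f : T -> R) (g : T -> X) (a : R) (x b : X) :
  f @ F --> a -> g @ F --> x -> (fun t => f t *: g t + b) @ F --> a *: x + b.
Proof.
move=> fa gx.
have fgx : (fun t => f t *: g t) @ F --> a *: x.
  exact: (@continuous2_cvg _ R^o _ _ _ _ f g (fun s u => s *: u)
    _ _ (@scale_continuous _ X (a, x)) fa gx).
exact: (continuous2_cvg _ (@add_continuous X (a *: x, b)) fgx (cvg_cst b)).
Qed.

Lemma continuous_affine (a : R) (b : X) : continuous (fun x : X => a *: x + b).
Proof. by move=> x; apply: cvgZD; [exact: cvg_cst|exact: cvg_id]. Qed.

Lemma continuous_line (v b : X) : continuous (fun t : R => t *: v + b).
Proof. by move=> t; apply: cvgZD; [exact: cvg_id|exact: cvg_cst]. Qed.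

Lemma interior_affine (A : set X) (a : R) (b x : X) :
  interior A (a *: x + b) -> \forall y \near x, A (a *: y + b).
Proof. exact: continuous_affine. Qed.

Lemma absorbing_nbhs (A : set X) (b v : X) :
  interior A b -> exists2 t : R, 0 < t & A (t *: v + b).
Proof.
move=> Ab.
have : \forall t \near (0 : R), A (t *: v + b).
  by apply: continuous_line; rewrite scale0r add0r.
move=> /nbhs_ballP[e /= e0 eA]; exists (e / 2); first by rewrite divr_gt0.
apply: eA; rewrite /ball/= sub0r normrN gtr0_norm ?divr_gt0//.
by rewrite ltr_pdivrMr// ltr_pMr// ltr1n.
Qed.

(** The map [u => t^-1 *: u - (t^-1 * (1 - t)) *: y] inverts [v => t *: v + (1 - t) *: y]; by
    continuity it sends points near the combination into [A], and convexity brings them back. *)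
Lemma interior_combo (A : set X) (t : R) x y :
  convex_set A -> 0 < t <= 1 -> interior A x -> A y ->
  interior A (t *: x + (1 - t) *: y).
Proof.
move=> cA /andP[t0 t1] Ax Ay.
rewrite /interior/=.
have : interior A (t^-1 *: (t *: x + (1 - t) *: y) + - (t^-1 * (1 - t)) *: y).
  by rewrite scalerDr !scalerA mulVf ?gt_eqF// scale1r scaleNr addrK.
move=> /interior_affine; apply: filterS => u Au.
have -> : u = t *: (t^-1 *: u + - (t^-1 * (1 - t)) *: y) + (1 - t) *: y.
  rewrite scalerDr !scalerA mulrN mulrA mulfV ?gt_eqF// mul1r scale1r.
  by rewrite scaleNr subrK.
by apply: convex_combo => //; rewrite (ltW t0).
Qed.

Lemma scalar_continuous (f : {scalar X}) (A : set X) :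
  nbhs 0 A -> (forall x, A x -> f x <= 1) -> continuous (f : X -> R).
Proof.
move=> A0 fA x; apply/cvgrPdist_lt => e e0.
have d0 : 0 < e / 2 by rewrite divr_gt0.
have nearA (a : R) : \forall y \near x, A (a *: y + - (a *: x)).
  by apply: (interior_affine A a (- (a *: x))); rewrite /interior/= subrr.
near=> y.
have f1 (a : R) : A (a *: y + - (a *: x)) -> a * (f y - f x) <= 1.
  by move=> /fA; rewrite -scalerBr linearZ/= raddfB.
(* The bound on [A] is one-sided, so both signs of the scaled difference are tested. *)
have h1 : (e / 2)^-1 * (f y - f x) <= 1 by apply: f1; near: y; exact: nearA.
have h2 : - (e / 2)^-1 * (f y - f x) <= 1 by apply: f1; near: y; exact: nearA.
apply: (@le_lt_trans _ _ (e / 2)); last first.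
  by rewrite ltr_pdivrMr// ltr_pMr// ltr1n.
rewrite ler_norml; move: h1 h2; rewrite mulNr -mulrN.
by rewrite ![(e / 2)^-1 * _]mulrC !ler_pdivrMr// !mul1r; lra.
Unshelve. all: by end_near.
Qed.

(** * The Minkowski functional and separation from a point *)

Definition gauge_set (A : set X) (x : X) : set R :=
  [set t | 0 < t /\ A (t^-1 *: x)].

Definition gauge (A : set X) (x : X) : R := inf (gauge_set A x).

Section gauge.
Variable A : set X.
Hypotheses (cA : convex_set A) (A0 : nbhs 0 A).

Lemma gauge_set_neq0 x : gauge_set A x !=set0.
Proof.
have [t t0] := absorbing_nbhs A 0 x A0.
by rewrite addr0 => Atx; exists t^-1; split; rewrite ?invr_gt0// invrK.
Qed.

Lemma gauge_ub x t : gauge_set A x t -> gauge A x <= t.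
Proof. by move=> xt; apply: ge_inf => //; exists 0 => s [/ltW]. Qed.

Lemma gauge_sublinear : sublinear (gauge A).
Proof.
split=> [x y|a x].
  apply: le_inf_add; [exact: gauge_set_neq0|exact: gauge_set_neq0|].
  move=> s t [s0 As] [t0 At]; apply: gauge_ub; split; first exact: addr_gt0.
  have st0 : 0 < s + t by exact: addr_gt0.
  (* The weights [s / (s + t)] and [t / (s + t)] exhibit the scaled sum as a convex combination of
     two points of [A]. *)
  have -> : (s + t)^-1 *: (x + y) =
      (s / (s + t)) *: (s^-1 *: x) + (1 - s / (s + t)) *: (t^-1 *: y).
    rewrite scalerDr !scalerA; congr (_ *: _ + _ *: _).
      by field; rewrite !gt_eqF.
    by field; rewrite !gt_eqF.
  apply: convex_combo => //; apply/andP; split.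
    by apply: divr_ge0; exact: ltW.
  by rewrite ler_pdivrMr// mul1r lerDl ltW.
rewrite le_eqVlt => /predU1P[<-|a0].
  rewrite scale0r mul0r; apply/ler_addgt0Pl => e e0; rewrite addr0.
  by apply: gauge_ub; split=> //; rewrite scaler0; exact: nbhs_singleton.
apply: le_inf_mul; [by []|exact: gauge_set_neq0|move=> t [t0 At]].
apply: gauge_ub; split; first exact: mulr_gt0.
by rewrite scalerA invfM -mulrA [t^-1 * a]mulrC mulrA mulVf ?gt_eqF// mul1r.
Qed.

Lemma gauge_le1 x : A x -> gauge A x <= 1.
Proof. by move=> Ax; apply: gauge_ub; split=> //; rewrite invr1 scale1r. Qed.

(** If some [t < 1] were in the gauge set, [x] would lie on the segment from [0] to [t^-1 *: x],
    inside [A]. *)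
Lemma gauge_ge1 x : ~ A x -> 1 <= gauge A x.
Proof.
move=> nAx; apply: lb_le_inf; first exact: gauge_set_neq0.
move=> t [t0 At]; rewrite leNgt; apply/negP => t1; apply: nAx.
have -> : x = t *: (t^-1 *: x) + (1 - t) *: 0.
  by rewrite scaler0 addr0 scalerA mulfV ?gt_eqF// scale1r.
by apply: convex_combo => //; [rewrite !ltW|exact: nbhs_singleton].
Qed.

End gauge.

(** Hahn-Banach for the gauge of [A] translated by [- b], with equality at [y - b]: the functional
    is at most 1 on the translate and at least 1 at [y - b]. The first bound also gives
    continuity. *)
Lemma convex_separation (A : set X) (b y : X) :
  convex_set A -> interior A b -> ~ A y ->
  exists f : {scalar X}, [/\ continuous (f : X -> R), f b < f y &
    forall x, A x -> f x <= f y].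
Proof.
move=> cA Ab nAy; pose B := [set x | A (x + b)].
have cB : convex_set B.
  apply: convex_setP => t u v t01 Au Av.
  have := convex_combo _ _ _ _ cA t01 Au Av; congr (A _).
  by rewrite !scalerDr addrACA -scalerDl [t + _]addrC subrK scale1r.
have B0 : nbhs 0 B.
  have := @interior_affine A 1 b 0; rewrite scale1r add0r => /(_ Ab).
  by apply: filterS => u; rewrite scale1r.
have [f [fB fy]] := hahn_banach_sublinear _ (y - b) (gauge_sublinear _ cB B0).
have fy1 : 1 <= f (y - b) by rewrite fy; apply: gauge_ge1; rewrite ?/B/= ?subrK.
exists f; split.
- apply: (@scalar_continuous f B) => // x Bx.
  exact: le_trans (fB x) (gauge_le1 _ _ Bx).
- by move: fy1; rewrite linearB/=; lra.
- move=> x Ax.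
  have : f (x - b) <= 1.
    by apply: le_trans (fB _) (gauge_le1 _ _ _); rewrite /B/= subrK.
  by move: fy1; rewrite !linearB/=; lra.
Qed.

End topological_vector_space.

(** * Lines directed by a strictly positive element *)

Section acceptance.
Context {R : realType} {X : topologicalLmodType R} (P : set X).
Implicit Types (A : set X) (z : X).

Definition upward_closed A : Prop := forall x y, A x -> cone_le P x y -> A y.

Lemma strictly_positiveZ (a : R) z :
  convex_cone P -> 0 < a -> strictly_positive P z ->
  strictly_positive P (a *: z).
Proof.
move=> [_ PZ] a0 [Pz zpos]; split; first by apply: PZ => //; exact: ltW.
by move=> f Pf f0; rewrite linearZ/= mulr_gt0//; exact: zpos.
Qed.

Lemma upward_closed_line A z x (m n : R) :
  convex_cone P -> P z -> upward_closed A ->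
  A (x + m *: z) -> m <= n -> A (x + n *: z).
Proof.
move=> [_ PZ] Pz upA Axm mn; apply: upA Axm _; rewrite /cone_le.
by rewrite opprD addrACA subrr add0r -scalerBl; apply: PZ; rewrite ?subr_ge0.
Qed.

(* A functional separating [y] from [A] is bounded on the line, hence vanishes
   at [z], and bounded along every direction of [P], hence is in the dual cone
   up to sign. *)
Lemma line_in_convex_upward_closed A z b :
  convex_cone P -> convex_set A -> upward_closed A -> interior A !=set0 ->
  strictly_positive P z -> (forall m : R, A (b + m *: z)) -> A = setT.
Proof.
move=> [_ PZ] cA upA [c Ac] [Pz zpos] Aline.
apply/seteqP; split=> // y _; apply: contrapT => nAy.
have [f [fc fcy fA]] := convex_separation _ _ _ cA Ac nAy.
have f_le0 v : (forall m : R, 0 <= m -> A (b + m *: v)) -> f v <= 0.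
  move=> Av; rewrite leNgt; apply/negP => fv0.
  (* With this [m], [f (b + m *: v)] exceeds [f y], although [b + m *: v] is in [A]. *)
  pose m := (`|f y - f b| + 1) / f v.
  have m0 : 0 <= m by rewrite divr_ge0 ?ltW// addr_ge0.
  have := fA _ (Av m m0); rewrite linearD linearZ/= divfK ?gt_eqF//.
  by have := ler_norm (f y - f b); lra.
have fP v : P v -> f v <= 0.
  move=> Pv; apply: f_le0 => m m0.
  apply: (upA b); first by have := Aline 0; rewrite scale0r addr0.
  by rewrite /cone_le addrC addKr; exact: PZ.
have fz : f z = 0.
  apply/eqP; rewrite eq_le fP//= -oppr_le0 -raddfN.
  by apply: f_le0 => m m0; rewrite scalerN -scaleNr.
(* [- f] is in the dual cone and is nonzero because [f c < f y], yet it vanishes at [z]. *)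
have g_lin : scalar (fun x => - f x).
  by move=> a u v; rewrite linearP/= opprD mulrN.
pose g : {scalar X} :=
  HB.pack (fun x => - f x) (GRing.isLinear.Build R X R *%R _ g_lin).
suff : 0 < g z by rewrite /g/= fz oppr0 ltxx.
apply: zpos.
- split=> [x|x Px]; last by rewrite oppr_ge0 fP.
  by apply: cvgN; exact: fc.
- move=> /funeqP g0; have := g0 c; have := g0 y; rewrite /= => fy0 fc0.
  by move: fcy; lra.
Qed.

Lemma line_meets_interior A z x :
  convex_cone P -> convex_set A -> upward_closed A -> interior A !=set0 ->
  strictly_positive P z -> exists m : R, interior A (x + m *: z).
Proof.
move=> Pcone cA upA [c Ac] zpos.
(* [B] is [A] plus the line spanned by [z]; it contains the whole line through [c], hence is the
   whole space. *)
pose B := [set y | exists m : R, A (y + m *: z)].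
have AB : A `<=` B by move=> y Ay; exists 0; rewrite scale0r addr0.
have cB : convex_set B.
  apply: convex_setP => t u v t01 [m Am] [n An]; exists (t * m + (1 - t) * n).
  have := convex_combo _ _ _ _ cA t01 Am An; congr (A _).
  by rewrite !scalerDr addrACA !scalerA -scalerDl.
have upB : upward_closed B.
  move=> u v [m Am] uv; exists m; apply: upA Am _.
  by rewrite /cone_le opprD addrACA subrr addr0.
have Bc : interior B !=set0 by exists c; exact: interiorS Ac.
have BT : B = setT.
  apply: (line_in_convex_upward_closed _ _ c Pcone cB upB Bc zpos) => m.
  exists (- m); rewrite -addrA -scalerDl subrr scale0r addr0.
  exact: interior_subset.
(* [x] is the midpoint of [c] and [2 x - c]. *)
have : B (2%:R *: x - c) by rewrite BT.
move=> [m Am]; exists (2^-1 * m).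
have <- : 2^-1 *: c + (1 - 2^-1) *: (2%:R *: x - c + m *: z) =
    x + (2^-1 * m) *: z.
  have -> : 1 - 2^-1 = 2^-1 :> R by lra.
  rewrite !scalerDr !scalerA mulVf// scale1r scalerN.
  by rewrite [x + _ + _]addrAC [LHS]addrC subrK.
by apply: interior_combo => //; rewrite invr_gt0 ltr0n/= invf_le1 ?ler1n.
Qed.

End acceptance.

(** * Stability of acceptance and rejection under small perturbations *)

Section level_sets.
Context {R : realType} {X : topologicalLmodType R} (P A : set X) (z : X).
Hypotheses (Pcone : convex_cone P) (cA : convex_set A).
Hypotheses (upA : upward_closed P A) (A0 : interior A !=set0).
Hypothesis zpos : strictly_positive P z.

(* [x + n *: z] is moved slightly towards an interior point of [A] on the same
   line. *)
Lemma near_above x (n r : R) :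
  A (x + n *: z) -> n < r -> \forall y \near x, A (y + r *: z).
Proof.
move=> An nr.
have [M AM] := line_meets_interior _ _ _ x Pcone cA upA A0 zpos.
(* Small enough that [t * M + (1 - t) * n <= r]; the added 1 keeps the denominator positive. *)
pose t := Num.min 1 ((r - n) / (`|M - n| + 1)).
have d0 : 0 < `|M - n| + 1 by rewrite ltr_wpDl.
have t0 : 0 < t by rewrite lt_min ltr01/= divr_gt0// subr_gt0.
have t1 : t <= 1 by rewrite ge_min lexx.
have tM : t * (M - n) <= r - n.
  have : t <= (r - n) / (`|M - n| + 1) by rewrite ge_min lexx orbT.
  rewrite ler_pdivlMr// => td; apply: le_trans td.
  by rewrite ler_pM2l//; have := ler_norm (M - n); lra.
have : interior A (t *: (x + M *: z) + (1 - t) *: (x + n *: z)).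
  by apply: interior_combo => //; rewrite t0.
have -> : t *: (x + M *: z) + (1 - t) *: (x + n *: z) =
    1 *: x + (t * M + (1 - t) * n) *: z.
  by rewrite !scalerDr addrACA !scalerA -!scalerDl [t + _]addrC subrK.
move=> /interior_affine; apply: filterS => y; rewrite scale1r => Ay.
by apply: (upward_closed_line _ _ _ _ _ _ Pcone zpos.1 upA Ay); lra.
Qed.

(* [x + n *: z] is a convex combination of [y + r *: z] and of a point near an
   interior point [x + M *: z] of [A]. *)
Lemma near_below x (n r : R) :
  ~ A (x + n *: z) -> r < n -> \forall y \near x, ~ A (y + r *: z).
Proof.
move=> nAn rn.
have [M AM] := line_meets_interior _ _ _ x Pcone cA upA A0 zpos.
have nM : n < M.
  rewrite ltNge; apply/negP => Mn; apply: nAn.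
  have AM' := interior_subset AM.
  exact: (upward_closed_line _ _ _ _ _ _ Pcone zpos.1 upA AM' Mn).
(* The weight for which [t * M + (1 - t) * r = n]. *)
pose t := (n - r) / (M - r).
have d0 : 0 < M - r by lra.
have t0 : 0 < t by rewrite divr_gt0// subr_gt0.
have t1 : t <= 1 by rewrite ler_pdivrMr//; lra.
(* [w y] solves [t *: w y + (1 - t) *: (y + r *: z) = x + n *: z]. *)
pose w y := (- ((1 - t) / t)) *: y + t^-1 *: (x + (n - (1 - t) * r) *: z).
have wx : w x = x + M *: z.
  rewrite /w scalerDr addrA -scalerDl scalerA; congr (_ + _ *: _).
    by rewrite -[RHS]scale1r; congr (_ *: _); field; rewrite gt_eqF.
  by rewrite /t; field; rewrite !gt_eqF//; lra.
have := AM; rewrite -wx => /interior_affine; apply: filterS => y Aw Ay.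
apply: nAn.
have -> : x + n *: z = t *: w y + (1 - t) *: (y + r *: z).
  rewrite /w !scalerDr !scalerA mulrN mulrCA divff ?gt_eqF// mulr1 scale1r.
  by rewrite mul1r scaleNr addrACA addNr add0r -addrA -scalerDl subrK.
by apply: convex_combo; rewrite // ltW.
Qed.

End level_sets.

(** * Finiteness and continuity of the risk measure *)

Theorem corollary3p14 (R : realType) (X : topologicalLmodType R)
    (P : set X) (A : set X) (S : R * X) :
  ordered_tvs P ->
  acceptance_set P A ->
  convex_set A ->
  interior A !=set0 ->
  traded_asset P S ->
  strictly_positive P S.2 ->
  (forall x : X, risk_measure A S x \is a fin_num) /\
  continuous (risk_measure A S).
Proof.
move=> [_ Pcone _] [_ AT upA] cA A0 [S0 _ _] Spos.
(* Absorbing the price into the payoff turns [m / S.1] into [m]. *)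
pose z := S.1^-1 *: S.2.
have zpos : strictly_positive P z.
  by apply: strictly_positiveZ; rewrite ?invr_gt0.
have rhoE x :
    risk_measure A S x = ereal_inf [set m%:E | m in [set m | A (x + m *: z)]].
  by congr (ereal_inf (image _ _)); apply/seteqP; split=> m /=;
    rewrite /z scalerA.
have rho_le x m : A (x + m *: z) -> (risk_measure A S x <= m%:E)%E.
  by move=> Am; rewrite rhoE; apply: ge_ereal_inf; exists m%:E => //; exists m.
have le_rho x m : ~ A (x + m *: z) -> (m%:E <= risk_measure A S x)%E.
  move=> nAm; rewrite rhoE; apply/ereal_infP => _ [n /= An <-].
  rewrite lee_fin leNgt; apply/negP => /ltW nm; apply: nAm.
  exact: (upward_closed_line _ _ _ _ _ _ Pcone zpos.1 upA An nm).
have rho_fin x : risk_measure A S x \is a fin_num.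
  have [m /interior_subset/rho_le xm] :=
    line_meets_interior _ _ _ x Pcone cA upA A0 zpos.
  have [n /le_rho xn] : exists n, ~ A (x + n *: z).
    apply/existsNP => Ax; apply: AT.
    exact: (line_in_convex_upward_closed _ _ _ x Pcone cA upA A0 zpos).
  rewrite fin_numE -ltNye -ltey (lt_le_trans (ltNyr n) xn).
  by rewrite (le_lt_trans xm (ltry m)).
split=> // x; rewrite /continuous_at -[risk_measure A S x]fineK//.
apply: cvg_EFin; [exact: nearW|].
apply/cvgrPdist_le => e e0; set r := fine (risk_measure A S x).
have rE : risk_measure A S x = r%:E by rewrite fineK.
have above : \forall y \near x, (risk_measure A S y <= (r + e)%:E)%E.
  have : (risk_measure A S x < (r + e)%:E)%E by rewrite rE lte_fin ltrDl.
  rewrite rhoE => /ereal_inf_lt[_ [n An <-]]; rewrite lte_fin => nr.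
  apply: filterS (near_above _ _ _ Pcone cA upA A0 zpos _ _ _ An nr) => y.
  exact: rho_le.
have below : \forall y \near x, ((r - e)%:E <= risk_measure A S y)%E.
  (* A level strictly between [r - e] and [r]: it is rejected at [x] and leaves the gap that
     [near_below] requires. *)
  have nA : ~ A (x + (r - e / 2) *: z).
    by move=> /rho_le; rewrite rE lee_fin; lra.
  have er : r - e < r - e / 2 by lra.
  apply: filterS (near_below _ _ _ Pcone cA upA A0 zpos _ _ _ nA er) => y.
  exact: le_rho.
near=> y.
have : (risk_measure A S y <= (r + e)%:E)%E by near: y.
have : ((r - e)%:E <= risk_measure A S y)%E by near: y.
rewrite -[risk_measure A S y]fineK// !lee_fin/= ler_norml.
by move=> h1 h2; apply/andP; split; lra.
Unshelve. all: by end_near.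
Qed.
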